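(* Let $n$ be a positive integer. Let $\Lambda^n$ be the set of all $(n+1)\times(n+1)$ complex matrices $M$ for which there exist complex numbers $a_0,a_1,\dots,a_n$ such that, for $1\le i,j\le n+1$, the $(i,j)$ entry of $M$ is $\binom{i-1}{j-1}a_{i-j}$ if $j\le i$ and $0$ if $j>i$. Let $P$ be the matrix in $\Lambda^n$ whose first column is given by $a_1=1$ and $a_k=0$ for $k\ne 1$; that is, the $(i+1,i)$ entry of $P$ is $i$ for $1\le i\le n$, and all other entries of $P$ are $0$. Then $\Lambda^n$ is the commutant of $P$, i.e. an $(n+1)\times(n+1)$ complex matrix $Q$ satisfies $PQ=QP$ if and only if $Q\in\Lambda^n$.
   Context: The commutant of $P$ is the set of all $(n+1)\times(n+1)$ complex matrices $Q$ with $PQ=QP$. *)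

(* Defs.v *)
From HB Require Import structures.
From mathcomp Require Import all_boot all_order all_algebra.
From mathcomp Require Import complex.
From mathcomp Require Import classical_sets reals.

Set Implicit Arguments.
Unset Strict Implicit.
Unset Printing Implicit Defensive.

Import GRing.Theory.
Local Open Scope ring_scope.
Local Open Scope classical_set_scope.
Local Open Scope complex_scope.

Section GeneralizedPascal.

Variables (R : realType) (n : nat).

(* Rows and columns are numbered from 0, so the binomial coefficient carries no
   shift. Since i - j <= n, [inord (i - j)] is the index i - j itself. *)
Definition gpascal (a : 'I_n.+1 -> R[i]) : 'M[R[i]]_n.+1 :=
  \matrix_(i, j) if (j <= i)%N then 'C(i, j)%:R * a (inord (i - j)) else 0.

Definition Lambda : set 'M[R[i]]_n.+1 := [set M | exists a, M = gpascal a].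

(* For n = 0 there is no index 1 and Pmx is the zero matrix. *)
Definition Pmx : 'M[R[i]]_n.+1 := gpascal (fun k => (k == 1%N :> nat)%:R).

Definition commutant (A : 'M[R[i]]_n.+1) : set 'M[R[i]]_n.+1 :=
  [set Q | comm_mx A Q].

Lemma PmxE i j : Pmx i j = if i == j.+1 :> nat then (j.+1)%:R else 0.
Proof.
rewrite mxE; case: (leqP j i) => [le_ji|lt_ij]; last first.
  by case: eqP => // eq_ij; rewrite eq_ij ltnNge leqnSn in lt_ij.
have lt_n : (i - j < n.+1)%N by apply: leq_ltn_trans (leq_subr j i) (ltn_ord i).
rewrite inordK // -(eqn_add2l j) subnKC // addn1.
by case: eqP => [->|_]; rewrite ?mulr1 ?mulr0 // binSn.
Qed.

End GeneralizedPascal.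

Arguments Lambda : clear implicits.
Arguments Pmx : clear implicits.

(* Main.v *)
(** Comparing the entries of PQ and QP, commutation with P says
    i Q(i-1,j) = (j+1) Q(i,j+1), the right side being 0 in the last column.
    By the absorption identity i C(i-1,j) = (j+1) C(i,j+1), the matrices of
    Lambda satisfy this recurrence, and it determines Q from its first column
    since j+1 is invertible. *)

Require Import Defs.
From mathcomp Require Import all_boot all_order all_algebra.
From mathcomp Require Import complex classical_sets reals.

Import GRing.Theory Num.Theory.
Local Open Scope ring_scope.
Local Open Scope complex_scope.

(* The case distinction in [gpascal] is redundant: the binomial vanishes there. *)
Lemma gpascalE (R : realType) (n : nat) (a : 'I_n.+1 -> R[i]) (i j : 'I_n.+1) :
  gpascal a i j = 'C(i, j)%:R * a (inord (i - j)).
Proof. by rewrite mxE; case: leqP => // lt_ij; rewrite bin_small ?mul0r. Qed.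

(* At i = 0 the junk index [i.-1 = 0] is harmless, the coefficient being 0. *)
Lemma mul_Pmx (R : realType) (n : nat) (Q : 'M[R[i]]_n.+1) (i j : 'I_n.+1) :
  (Pmx R n *m Q) i j = i%:R * Q (inord i.-1) j.
Proof.
rewrite mxE; have [i0|i_gt0] := posnP i.
  by rewrite i0 mul0r big1 // => k _; rewrite PmxE i0 mul0r.
have lt_pi : (i.-1 < n.+1)%N by apply: leq_ltn_trans (leq_pred i) (ltn_ord i).
rewrite (bigD1 (inord i.-1)) //= PmxE inordK // prednK // eqxx.
rewrite big1 ?addr0 // => k neq_k; rewrite PmxE.
by case: eqP => [eq_ik|_]; [rewrite eq_ik /= inord_val eqxx in neq_k|rewrite mul0r].
Qed.

(** Column [j] of [Pmx] has its only nonzero entry in row [j.+1], a row that does not exist when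
    [j = n]. *)
Lemma mulmx_Pmx (R : realType) (n : nat) (Q : 'M[R[i]]_n.+1) (i j : 'I_n.+1) :
  (Q *m Pmx R n) i j =
  if (j < n)%N then j.+1%:R * Q i (inord j.+1) else 0.
Proof.
rewrite mxE; case: ltnP => [lt_jn|le_nj]; last first.
  rewrite big1 // => k _; rewrite PmxE; case: eqP => [eq_kj|_]; last exact: mulr0.
  by move: (ltn_ord k); rewrite eq_kj !ltnS ltnNge le_nj.
rewrite (bigD1 (inord j.+1)) //= PmxE inordK // eqxx mulrC.
rewrite big1 ?addr0 // => k neq_k; rewrite PmxE.
by case: eqP => [eq_kj|_]; [rewrite -eq_kj inord_val eqxx in neq_k|rewrite mulr0].
Qed.

Lemma gpascal_comm (R : realType) (n : nat) (a : 'I_n.+1 -> R[i]) :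
  comm_mx (Pmx R n) (gpascal a).
Proof.
apply/matrixP => i j; rewrite mul_Pmx mulmx_Pmx !gpascalE.
have lt_pi : (i.-1 < n.+1)%N by apply: leq_ltn_trans (leq_pred i) (ltn_ord i).
rewrite inordK // mulrA -natrM mul_bin_diag; case: ltnP => [lt_jn|le_nj].
  by rewrite inordK // mulrA -natrM -subn1 -subnDA add1n.
(* In the last column the binomial has become ['C(i, n.+1)], which vanishes as [i <= n]. *)
by rewrite bin_small ?muln0 ?mul0r // (leq_trans (ltn_ord i)).
Qed.

Lemma comm_Pmx_gpascal (R : realType) (n : nat) (Q : 'M[R[i]]_n.+1) :
  comm_mx (Pmx R n) Q -> Q = gpascal (fun k => Q k ord0).
Proof.
move=> PQ.
(* The column is a natural number [m] to allow induction, over all rows at once: entry [(i, m.+1)]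
   is obtained from entry [(i.-1, m)]. *)
suff colQ m (i : 'I_n.+1) : (m < n.+1)%N ->
    Q i (inord m) = 'C(i, m)%:R * Q (inord (i - m)) ord0.
  by apply/matrixP => i j; rewrite gpascalE -colQ ?inord_val.
elim: m i => [|m IHm] i lt_m.
  rewrite bin0 mul1r subn0 inord_val; congr (Q i _).
  by apply: val_inj; rewrite /= inordK.
have /matrixP/(_ i (inord m)) := PQ.
have lt_pi : (i.-1 < n.+1)%N by apply: leq_ltn_trans (leq_pred i) (ltn_ord i).
have lt_m' := ltnW lt_m.
rewrite mul_Pmx mulmx_Pmx IHm // !inordK // -ltnS lt_m mulrA -natrM.
rewrite mul_bin_diag natrM -mulrA -subn1 -subnDA add1n => eqQ.
by apply/esym; apply: mulfI eqQ; rewrite pnatr_eq0.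
Qed.

Theorem theorem2p1 (R : realType) (n : nat) (hn : (0 < n)%N) :
  Lambda R n = commutant (Pmx R n).
Proof.
apply/seteqP; split=> [_ [a ->]|Q /comm_Pmx_gpascal defQ] /=.
  exact: gpascal_comm.
by exists (fun k => Q k ord0).
Qed.
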